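(* Let $B:\mathfrak g_2\to\mathfrak g_1$ be a deformation map of type II of a (strict) quasi-twilled Lie triple system $(\mathcal G,\mathfrak g_1,\mathfrak g_2)$ over a field of characteristic $0$. Define a linear map $\delta:\wedge^2\mathfrak g_1\to\mathrm{Hom}(\mathfrak g_2,\mathfrak g_1)$ by $$\delta(x,y)v:=B[x,y,v]_2+B[x,y,B(v)]_2-[x,y,B(v)]_1,\qquad x,y\in\mathfrak g_1,\ v\in\mathfrak g_2.$$ Then for all $x,y\in\mathfrak g_1$, $\delta(x,y)$ is a $1$-cocycle of the Lie triple system $(\mathfrak g_2,[\cdot,\cdot,\cdot]_B)$ associated to the representation $(\mathfrak g_1;\varrho)$, where for $u,v,w\in\mathfrak g_2$, $x\in\mathfrak g_1$ $$[u,v,w]_B:=[u,v,w]_2+[B(u),B(v),B(w)]_2+[B(u),B(v),w]_2+[u,B(v),B(w)]_2-[v,B(u),B(w)]_2,$$ $$\varrho(u,v)x:=[x,u,v]_1+[x,B(u),B(v)]_1-B[x,B(u),B(v)]_2-B\big([x,B(u),v]_2-[u,x,B(v)]_2\big).$$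
   Context: All vector spaces are over a field of characteristic $0$. A Lie triple system is a vector space $\mathfrak g$ with a trilinear bracket $[\cdot,\cdot,\cdot]$, skew-symmetric in the first two arguments, such that $[x,y,z]+[y,z,x]+[z,x,y]=0$ and $[x,y,[z,w,t]]=[[x,y,z],w,t]+[z,[x,y,w],t]+[z,w,[x,y,t]]$. Let $(\mathcal G,[\cdot,\cdot,\cdot]_{\mathcal G})$ be a Lie triple system with a decomposition into subspaces $\mathcal G=\mathfrak g_1\oplus\mathfrak g_2$. For $a,b,c\in\mathcal G$ let $[a,b,c]_i$ denote the $\mathfrak g_i$-component of $[a,b,c]_{\mathcal G}$, $i=1,2$; elements of $\mathfrak g_1$ are denoted $x,y,z$, those of $\mathfrak g_2$ are denoted $u,v,w$. The triple $(\mathcal G,\mathfrak g_1,\mathfrak g_2)$ is quasi-twilled if $\mathfrak g_2$ is a subalgebra. It is strict if moreover $[x,y,w]_1=0$, $[u,y,z]_1=0$, $[u,v,z]_2=0$, $[x,v,w]_2=0$ for all $x,y,z\in\mathfrak g_1$, $u,v,w\in\mathfrak g_2$. Here quasi-twilled Lie triple systems are always assumed strict. A deformation map of type II is a linear map $B:\mathfrak g_2\to\mathfrak g_1$ such that for all $u,v,w\in\mathfrak g_2$ $$[Bu,Bv,Bw]_1+[u,v,Bw]_1+[Bu,v,w]_1-[Bv,u,w]_1=B\big([Bu,Bv,w]_2+[u,Bv,Bw]_2-[v,Bu,Bw]_2+[Bu,Bv,Bw]_2+[u,v,w]_2\big).$$ A representation of a Lie triple system $\mathfrak g$ on a vector space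 $V$ is a bilinear map $\rho:\otimes^2\mathfrak g\to\mathfrak{gl}(V)$ such that, with $D_\rho(x,y)=\rho(y,x)-\rho(x,y)$, one has $\rho(z,w)\rho(x,y)-\rho(y,w)\rho(x,z)-\rho(x,[y,z,w])+D_\rho(y,z)\rho(x,w)=0$ and $\rho([x,y,z],w)+\rho(z,[x,y,w])=[D_\rho(x,y),\rho(z,w)]$ (commutator). Known fact: $(\mathfrak g_2,[\cdot,\cdot,\cdot]_B)$ is a Lie triple system and $(\mathfrak g_1;\varrho)$ is a representation of it. For a representation $(V;\rho)$ of $\mathfrak g$, a linear map $f:\mathfrak g\to V$ is a $1$-cocycle (in Yamaguti cohomology) if $(\mathrm d f)(x_1,x_2,x_3)=\rho(x_2,x_3)f(x_1)-\rho(x_1,x_3)f(x_2)+D_\rho(x_1,x_2)f(x_3)-f([x_1,x_2,x_3])$ vanishes for all $x_1,x_2,x_3\in\mathfrak g$. *)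

(* Defs.v *)
From HB Require Import structures.
From mathcomp Require Import all_boot all_algebra.

Set Implicit Arguments.
Unset Strict Implicit.
Unset Printing Implicit Defensive.

Import GRing.Theory.
Local Open Scope ring_scope.

(* A plain record rather than an HB structure: the vector space g2 carries
   several brackets, namely the restriction of that of G and the brackets
   [.,.,.]_B. *)
Record lieTripleSystem (K : fieldType) (g : lmodType K) := LieTripleSystem {
  ltsbr :> g -> g -> g -> g;
  ltsbr_linear1 : forall y z, linear (fun x => ltsbr x y z);
  ltsbr_linear2 : forall x z, linear (fun y => ltsbr x y z);
  ltsbr_linear3 : forall x y, linear (ltsbr x y);
  ltsbr_skew : forall x y z, ltsbr x y z = - ltsbr y x z;
  ltsbr_cyclic : forall x y z, ltsbr x y z + ltsbr y z x + ltsbr z x y = 0;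
  ltsbr_fundamental : forall x y z w t,
    ltsbr x y (ltsbr z w t) =
      ltsbr (ltsbr x y z) w t + ltsbr z (ltsbr x y w) t
      + ltsbr z w (ltsbr x y t)
}.

Definition repD (K : fieldType) (g V : lmodType K)
  (rho : g -> g -> {linear V -> V}) (x y : g) (a : V) : V :=
  rho y x a - rho x y a.

(* gl(V) is {linear V -> V}; identities in gl(V) are stated pointwise. *)
Record ltsRepresentation (K : fieldType) (g : lmodType K)
    (L : lieTripleSystem g) (V : lmodType K) := LtsRepresentation {
  ltsrep :> g -> g -> {linear V -> V};
  ltsrep_linear1 : forall y a, linear (fun x => ltsrep x y a);
  ltsrep_linear2 : forall x a, linear (fun y => ltsrep x y a);
  ltsrep_ax1 : forall x y z w a,
    ltsrep z w (ltsrep x y a) - ltsrep y w (ltsrep x z a)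
    - ltsrep x (L y z w) a + repD ltsrep y z (ltsrep x w a) = 0;
  ltsrep_ax2 : forall x y z w a,
    ltsrep (L x y z) w a + ltsrep z (L x y w) a =
      repD ltsrep x y (ltsrep z w a) - ltsrep z w (repD ltsrep x y a)
}.

Definition coboundary1 (K : fieldType) (g : lmodType K)
    (L : lieTripleSystem g) (V : lmodType K) (rho : ltsRepresentation L V)
    (f : {linear g -> V}) (x1 x2 x3 : g) : V :=
  rho x2 x3 (f x1) - rho x1 x3 (f x2) + repD rho x1 x2 (f x3) - f (L x1 x2 x3).

Definition is_1cocycle (K : fieldType) (g : lmodType K)
    (L : lieTripleSystem g) (V : lmodType K) (rho : ltsRepresentation L V)
    (f : {linear g -> V}) : Prop :=
  forall x1 x2 x3, coboundary1 rho f x1 x2 x3 = 0.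

(* Linear maps from the exterior square of U to Hom(V, W), given by the
   corresponding skew-symmetric bilinear maps on U (in characteristic 0
   skew-symmetric and alternating are the same). *)
Record wedge2Hom (K : fieldType) (U V W : lmodType K) := Wedge2Hom {
  wedge2fun :> U -> U -> {linear V -> W};
  wedge2_linear1 : forall y v, linear (fun x => wedge2fun x y v);
  wedge2_linear2 : forall x v, linear (fun y => wedge2fun x y v);
  wedge2_skew : forall x y v, wedge2fun x y v = - wedge2fun y x v
}.

Section LinearityClosure.
Variables (K : fieldType) (U V W : lmodType K).

Lemma linear_fun_add (f g : U -> V) :
  linear f -> linear g -> linear (fun x => f x + g x).
Proof. by move=> lf lg k x y; rewrite lf lg addrACA -scalerDr. Qed.

Lemma linear_fun_opp (f : U -> V) : linear f -> linear (fun x => - f x).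
Proof. by move=> lf k x y; rewrite lf opprD scalerN. Qed.

Lemma linear_fun_comp (f : V -> W) (g : U -> V) :
  linear f -> linear g -> linear (fun x => f (g x)).
Proof. by move=> lf lg k x y; rewrite lg lf. Qed.

End LinearityClosure.

Section QuasiTwilled.
Variables (K : fieldType) (G : lmodType K) (S1 S2 : pred G).
(* The subspaces S1 and S2 of G, as vector spaces in their own right; val is
   the linear inclusion into G. *)
Variables (g1 : subLmodType S1) (g2 : subLmodType S2).

Definition direct_decomposition : Prop :=
  (forall a : G, exists p : g1 * g2, a == val p.1 + val p.2)
  /\ (forall a : G, a \in S1 -> a \in S2 -> a = 0).

Definition component1 (dec : direct_decomposition) (a : G) : g1 :=
  (xchoose (dec.1 a)).1.
Definition component2 (dec : direct_decomposition) (a : G) : g2 :=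
  (xchoose (dec.1 a)).2.

Definition quasi_twilled (L : lieTripleSystem G) : Prop :=
  forall u v w : g2, L (val u) (val v) (val w) \in S2.

Definition strict_quasi_twilled (L : lieTripleSystem G)
    (dec : direct_decomposition) : Prop :=
  quasi_twilled L /\
  [/\ forall (x y : g1) (w : g2),
        component1 dec (L (val x) (val y) (val w)) = 0,
      forall (u : g2) (y z : g1),
        component1 dec (L (val u) (val y) (val z)) = 0,
      forall (u v : g2) (z : g1),
        component2 dec (L (val u) (val v) (val z)) = 0
    & forall (x : g1) (v w : g2),
        component2 dec (L (val x) (val v) (val w)) = 0].

Variables (L : lieTripleSystem G) (dec : direct_decomposition).

Local Notation "[ a , b , c ]_1" := (component1 dec (L a b c))
  (at level 0, a, b, c at level 99, format "[ a ,  b ,  c ]_1").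
Local Notation "[ a , b , c ]_2" := (component2 dec (L a b c))
  (at level 0, a, b, c at level 99, format "[ a ,  b ,  c ]_2").

Definition deformation_map_II (B : {linear g2 -> g1}) : Prop :=
  forall u v w : g2,
    [val (B u), val (B v), val (B w)]_1 + [val u, val v, val (B w)]_1
    + [val (B u), val v, val w]_1 - [val (B v), val u, val w]_1
    = B ([val (B u), val (B v), val w]_2 + [val u, val (B v), val (B w)]_2
         - [val v, val (B u), val (B w)]_2
         + [val (B u), val (B v), val (B w)]_2 + [val u, val v, val w]_2).

Variable B : {linear g2 -> g1}.

Definition deformed_bracket (u v w : g2) : g2 :=
  [val u, val v, val w]_2 + [val (B u), val (B v), val (B w)]_2
  + [val (B u), val (B v), val w]_2 + [val u, val (B v), val (B w)]_2
  - [val v, val (B u), val (B w)]_2.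

Definition deformed_action (u v : g2) (x : g1) : g1 :=
  [val x, val u, val v]_1 + [val x, val (B u), val (B v)]_1
  - B [val x, val (B u), val (B v)]_2
  - B ([val x, val (B u), val v]_2 - [val u, val x, val (B v)]_2).

Definition delta_fun (x y : g1) (v : g2) : g1 :=
  B [val x, val y, val v]_2 + B [val x, val y, val (B v)]_2
  - [val x, val y, val (B v)]_1.

Lemma component_sum a :
  a = val (component1 dec a) + val (component2 dec a).
Proof. exact/eqP/(xchooseP (dec.1 a)). Qed.

Lemma component_uniq (x x' : g1) (u u' : g2) :
  val x + val u = val x' + val u' -> x = x' /\ u = u'.
Proof.
move=> e.
have e' : val (x - x') = val (u' - u).
  rewrite !raddfB; apply/eqP; rewrite subr_eq addrAC eq_sym subr_eq.
  by rewrite e addrC.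
have z0 : val (x - x') = 0.
  by apply: dec.2; [exact: valP | rewrite e'; exact: valP].
split; apply/eqP; rewrite -subr_eq0.
  by apply/eqP/val_inj; rewrite z0 raddf0.
by rewrite -oppr_eq0 opprB; apply/eqP/val_inj; rewrite -e' z0 raddf0.
Qed.

Lemma component1_is_linear : linear (component1 dec).
Proof.
move=> k a b; apply: (proj1 (component_uniq (u := component2 dec (k *: a + b))
  (u' := k *: component2 dec a + component2 dec b) _)).
rewrite -component_sum !linearP /= addrACA -scalerDr.
by rewrite -!component_sum.
Qed.

Lemma component2_is_linear : linear (component2 dec).
Proof.
move=> k a b; apply: (proj2 (component_uniq (x := component1 dec (k *: a + b))
  (x' := k *: component1 dec a + component1 dec b) _)).
rewrite -component_sum !linearP /= addrACA -scalerDr.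
by rewrite -!component_sum.
Qed.

HB.instance Definition _ := GRing.isLinear.Build K G g1 *:%R
  (component1 dec) component1_is_linear.
HB.instance Definition _ := GRing.isLinear.Build K G g2 *:%R
  (component2 dec) component2_is_linear.

Lemma component1D a b :
  component1 dec (a + b) = component1 dec a + component1 dec b.
Proof. exact: raddfD. Qed.
Lemma component2D a b :
  component2 dec (a + b) = component2 dec a + component2 dec b.
Proof. exact: raddfD. Qed.
Lemma component1N a : component1 dec (- a) = - component1 dec a.
Proof. exact: raddfN. Qed.
Lemma component2N a : component2 dec (- a) = - component2 dec a.
Proof. exact: raddfN. Qed.

Lemma component1_val1 (x : g1) : component1 dec (val x) = x.
Proof.
have := component_sum (val x); rewrite -[LHS]addr0 -[X in _ + X = _](raddf0 (val : g2 -> G)).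
by move/component_uniq => [].
Qed.
Lemma component1_val2 (u : g2) : component1 dec (val u) = 0.
Proof.
have := component_sum (val u); rewrite -[LHS]add0r -[X in X + _ = _](raddf0 (val : g1 -> G)).
by move/component_uniq => [].
Qed.
Lemma component2_val1 (x : g1) : component2 dec (val x) = 0.
Proof.
have := component_sum (val x); rewrite -[LHS]addr0 -[X in _ + X = _](raddf0 (val : g2 -> G)).
by move/component_uniq => [].
Qed.
Lemma component2_val2 (u : g2) : component2 dec (val u) = u.
Proof.
have := component_sum (val u); rewrite -[LHS]add0r -[X in X + _ = _](raddf0 (val : g1 -> G)).
by move/component_uniq => [].
Qed.

Lemma lts_val_linear1 (S : pred G) (g : subLmodType S) b c :
  linear (fun x : g => L (val x) b c).
Proof.
exact: linear_fun_comp (ltsbr_linear1 L b c) (linearP (val : g -> G)).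
Qed.
Lemma lts_val_linear2 (S : pred G) (g : subLmodType S) a c :
  linear (fun y : g => L a (val y) c).
Proof.
exact: linear_fun_comp (ltsbr_linear2 L a c) (linearP (val : g -> G)).
Qed.
Lemma lts_val_linear3 (S : pred G) (g : subLmodType S) a b :
  linear (fun z : g => L a b (val z)).
Proof.
exact: linear_fun_comp (ltsbr_linear3 L a b) (linearP (val : g -> G)).
Qed.

Lemma component1_comp_linear (U : lmodType K) (f : U -> G) :
  linear f -> linear (fun x => component1 dec (f x)).
Proof. exact: linear_fun_comp component1_is_linear. Qed.
Lemma component2_comp_linear (U : lmodType K) (f : U -> G) :
  linear f -> linear (fun x => component2 dec (f x)).
Proof. exact: linear_fun_comp component2_is_linear. Qed.
Lemma B_comp_linear (U : lmodType K) (f : U -> g2) :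
  linear f -> linear (fun x => B (f x)).
Proof. exact: linear_fun_comp (linearP B). Qed.

Lemma deformed_action_is_linear u v : linear (deformed_action u v).
Proof.
rewrite /deformed_action.
apply: linear_fun_add.
  apply: linear_fun_add.
    apply: linear_fun_add; apply: component1_comp_linear;
      exact: lts_val_linear1.
  apply/linear_fun_opp/B_comp_linear/component2_comp_linear.
  exact: lts_val_linear1.
apply/linear_fun_opp/B_comp_linear/linear_fun_add.
  exact/component2_comp_linear/lts_val_linear1.
exact/linear_fun_opp/component2_comp_linear/lts_val_linear2.
Qed.
HB.instance Definition _ u v := GRing.isLinear.Build K g1 g1 *:%R
  (deformed_action u v) (deformed_action_is_linear u v).
Definition deformed_endo (u v : g2) : {linear g1 -> g1} := deformed_action u v.

Lemma delta_fun_is_linear x y : linear (delta_fun x y).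
Proof.
have l3 : linear (fun v => L (val x) (val y) (val (B v))).
  apply: (linear_fun_comp (f := fun x' : g1 => L (val x) (val y) (val x'))).
    exact: lts_val_linear3.
  exact: linearP.
apply: linear_fun_add.
  apply: linear_fun_add; apply/B_comp_linear/component2_comp_linear => //.
  exact: lts_val_linear3.
exact/linear_fun_opp/component1_comp_linear.
Qed.
HB.instance Definition _ x y := GRing.isLinear.Build K g2 g1 *:%R
  (delta_fun x y) (delta_fun_is_linear x y).
Definition delta_hom (x y : g1) : {linear g2 -> g1} := delta_fun x y.

Lemma delta_linear1 y v : linear (fun x => delta_hom x y v).
Proof.
apply: linear_fun_add; last first.
  exact/linear_fun_opp/component1_comp_linear/lts_val_linear1.
by apply: linear_fun_add; apply/B_comp_linear/component2_comp_linear;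
  exact: lts_val_linear1.
Qed.
Lemma delta_linear2 x v : linear (fun y => delta_hom x y v).
Proof.
apply: linear_fun_add; last first.
  exact/linear_fun_opp/component1_comp_linear/lts_val_linear2.
by apply: linear_fun_add; apply/B_comp_linear/component2_comp_linear;
  exact: lts_val_linear2.
Qed.
Lemma delta_skew x y v : delta_hom x y v = - delta_hom y x v.
Proof.
rewrite /= /delta_fun !(ltsbr_skew L (val x) (val y)).
by rewrite (raddfN (component1 dec)) !(raddfN (component2 dec)) !raddfN !opprD.
Qed.

Definition delta : wedge2Hom g1 g2 g1 :=
  Wedge2Hom delta_linear1 delta_linear2 delta_skew.

Lemma ltsD1 a a' b c : L (a + a') b c = L a b c + L a' b c.
Proof. by have := ltsbr_linear1 L b c 1 a a'; rewrite !scale1r. Qed.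
Lemma ltsD2 a b b' c : L a (b + b') c = L a b c + L a b' c.
Proof. by have := ltsbr_linear2 L a c 1 b b'; rewrite !scale1r. Qed.
Lemma ltsD3 a b c c' : L a b (c + c') = L a b c + L a b c'.
Proof. by have := ltsbr_linear3 L a b 1 c c'; rewrite !scale1r. Qed.

Lemma lts01 b c : L 0 b c = 0.
Proof. by apply: (addIr (L 0 b c)); rewrite -ltsD1 !add0r. Qed.
Lemma ltsN1 a b c : L (- a) b c = - L a b c.
Proof. by apply/eqP; rewrite -addr_eq0 -ltsD1 addNr lts01. Qed.

(* deformation_map_II says that the graph of B is a subalgebra of G. Then
   graph_embedding identifies g2 with this graph and graph_quotient is the
   projection of G onto g1 along it; they transport the bracket of G to
   deformed_bracket and deformed_action. *)
Definition graph_embedding (u : g2) : G := val (B u) + val u.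
Definition graph_quotient (a : G) : g1 :=
  component1 dec a - B (component2 dec a).
Local Notation phi := graph_embedding.
Local Notation q := graph_quotient.

Lemma graph_embedding_is_linear : linear phi.
Proof. by move=> k u v; rewrite /phi !linearP /= addrACA -scalerDr. Qed.
Lemma graph_quotient_is_linear : linear q.
Proof.
move=> k a b; rewrite /q component1_is_linear component2_is_linear.
by rewrite linearP opprD addrACA -scalerN -scalerDr.
Qed.
HB.instance Definition _ := GRing.isLinear.Build K g2 G *:%R
  graph_embedding graph_embedding_is_linear.
HB.instance Definition _ := GRing.isLinear.Build K G g1 *:%R
  graph_quotient graph_quotient_is_linear.

Lemma graph_embeddingD u v : phi (u + v) = phi u + phi v.
Proof. exact: raddfD. Qed.
Lemma graph_quotientD a b : q (a + b) = q a + q b.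
Proof. exact: raddfD. Qed.
Lemma graph_quotientB a b : q (a - b) = q a - q b.
Proof. exact: raddfB. Qed.

Lemma graph_quotient_val1 (x : g1) : q (val x) = x.
Proof. by rewrite /q component1_val1 component2_val1 raddf0 subr0. Qed.
Lemma graph_quotient_embedding u : q (phi u) = 0.
Proof.
rewrite /q /phi component1D component2D component1_val1 component1_val2.
by rewrite component2_val1 component2_val2 addr0 add0r subrr.
Qed.
Lemma graph_decomposition a : a = val (q a) + phi (component2 dec a).
Proof.
by rewrite /q /phi raddfB addrA subrK -component_sum.
Qed.
Lemma component2_graph_embedding u : component2 dec (phi u) = u.
Proof. by rewrite /phi component2D component2_val1 component2_val2 add0r. Qed.
Lemma graph_embedding_inj : injective phi.
Proof. by move=> u v e; rewrite -(component2_graph_embedding u) e component2_graph_embedding. Qed.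

Hypotheses (hG : strict_quasi_twilled L dec) (hB : deformation_map_II B).

Lemma strictE :
  ((forall u v w : g2, [val u, val v, val w]_1 = 0)
   * (forall (x y : g1) (w : g2), [val x, val y, val w]_1 = 0)
   * (forall (u : g2) (y z : g1), [val u, val y, val z]_1 = 0)
   * (forall (y : g1) (u : g2) (z : g1), [val y, val u, val z]_1 = 0)
   * (forall (u v : g2) (z : g1), [val u, val v, val z]_2 = 0)
   * (forall (x : g1) (v w : g2), [val x, val v, val w]_2 = 0)
   * (forall (v : g2) (x : g1) (w : g2), [val v, val x, val w]_2 = 0))%type.
Proof.
case: hG => sub [s1 s2 s3 s4]; do !split=> //.
- move=> u v w; rewrite -(SubK g2 (sub u v w)).
  exact: component1_val2.
- by move=> y u z; rewrite ltsbr_skew (component1N,component2N) s2 oppr0.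
- by move=> v x w; rewrite ltsbr_skew (component1N,component2N) s4 oppr0.
Qed.

Lemma component2_graph_bracket u v w :
  component2 dec (L (phi u) (phi v) (phi w)) = deformed_bracket u v w.
Proof.
rewrite /phi /deformed_bracket !(ltsD1, ltsD2, ltsD3).
rewrite !(component1D, component2D) !strictE.
rewrite (ltsbr_skew L (val (B u)) (val v)) ?(component1N,component2N) ?addr0 ?add0r.

by rewrite [LHS](AC (3*2) (5*1*2*4*3)).
Qed.

Lemma graph_quotient_bracket u v w : q (L (phi u) (phi v) (phi w)) = 0.
Proof.
have := hB u v w.
rewrite /q /phi !(ltsD1, ltsD2, ltsD3).
rewrite !(component1D, component2D) !strictE.
rewrite (ltsbr_skew L (val u) (val (B v)) (val w)).
rewrite (ltsbr_skew L (val (B u)) (val v) (val (B w))) ?(component1N,component2N).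
rewrite ?addr0 ?add0r.
move/eqP; rewrite -subr_eq0 => /eqP e; rewrite -[RHS]e.
by congr (_ - B _); [rewrite (AC (2*2) (1*4*2*3))
                   | rewrite (AC (3*2) (2*4*3*1*5))].
Qed.
Lemma graph_quotient_action u v x :
  q (L (val x) (phi u) (phi v)) = deformed_action u v x.
Proof.
rewrite /q /phi /deformed_action !(ltsD1, ltsD2, ltsD3).
rewrite !(component1D, component2D) !strictE.
rewrite (ltsbr_skew L (val x) (val u) (val (B v))) ?(component1N,component2N).
rewrite ?addr0 ?add0r.
rewrite [X in X - _]addrC -addrA [RHS]addrAC -!addrA; congr (_ + (_ + _)).
by rewrite -!opprD -raddfD [X in _ = - B X]addrC.
Qed.

Lemma graph_embedding_bracket u v w :
  phi (deformed_bracket u v w) = L (phi u) (phi v) (phi w).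
Proof.
rewrite [RHS]graph_decomposition graph_quotient_bracket raddf0 add0r.
by rewrite component2_graph_bracket.
Qed.

Lemma graph_quotient_bracket_val a u v :
  q (L (val (q a)) (phi u) (phi v)) = q (L a (phi u) (phi v)).
Proof.
rewrite [in RHS](graph_decomposition a) ltsD1 graph_quotientD.
by rewrite graph_quotient_bracket addr0.
Qed.

Lemma lts_action a b c : L a b c = L c b a - L c a b.
Proof.
have /eqP := ltsbr_cyclic L a b c.
by rewrite (ltsbr_skew L b c a) -addrA addr_eq0 opprD opprK => /eqP.
Qed.

Lemma deformed_bracket_linear1 v w :
  linear (fun u => deformed_bracket u v w).
Proof.
move=> k a b; apply: graph_embedding_inj.
rewrite [RHS]graph_embedding_is_linear !graph_embedding_bracket.
by rewrite graph_embedding_is_linear ltsbr_linear1.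
Qed.
Lemma deformed_bracket_linear2 u w :
  linear (fun v => deformed_bracket u v w).
Proof.
move=> k a b; apply: graph_embedding_inj.
rewrite [RHS]graph_embedding_is_linear !graph_embedding_bracket.
by rewrite graph_embedding_is_linear ltsbr_linear2.
Qed.
Lemma deformed_bracket_linear3 u v : linear (deformed_bracket u v).
Proof.
move=> k a b; apply: graph_embedding_inj.
rewrite [RHS]graph_embedding_is_linear !graph_embedding_bracket.
by rewrite graph_embedding_is_linear ltsbr_linear3.
Qed.
Lemma deformed_bracket_skew u v w :
  deformed_bracket u v w = - deformed_bracket v u w.
Proof.
apply: graph_embedding_inj.
by rewrite raddfN /= !graph_embedding_bracket ltsbr_skew.
Qed.
Lemma deformed_bracket_cyclic u v w :
  deformed_bracket u v w + deformed_bracket v w u + deformed_bracket w u v = 0.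
Proof.
apply: graph_embedding_inj.
by rewrite 2!graph_embeddingD !graph_embedding_bracket ltsbr_cyclic raddf0.
Qed.
Lemma deformed_bracket_fundamental x y z w t :
  deformed_bracket x y (deformed_bracket z w t) =
    deformed_bracket (deformed_bracket x y z) w t
    + deformed_bracket z (deformed_bracket x y w) t
    + deformed_bracket z w (deformed_bracket x y t).
Proof.
apply: graph_embedding_inj.
by rewrite 2!graph_embeddingD !graph_embedding_bracket ltsbr_fundamental.
Qed.

Definition deformed_lts : lieTripleSystem g2 :=
  LieTripleSystem deformed_bracket_linear1 deformed_bracket_linear2
    deformed_bracket_linear3 deformed_bracket_skew deformed_bracket_cyclic
    deformed_bracket_fundamental.

Lemma deformed_action_linear1 v x :
  linear (fun u => deformed_endo u v x).
Proof.
move=> k a b; rewrite /= -!graph_quotient_action graph_embedding_is_linear.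
by rewrite ltsbr_linear2 graph_quotient_is_linear.
Qed.
Lemma deformed_action_linear2 u x :
  linear (fun v => deformed_endo u v x).
Proof.
move=> k a b; rewrite /= -!graph_quotient_action graph_embedding_is_linear.
by rewrite ltsbr_linear3 graph_quotient_is_linear.
Qed.
Lemma deformed_action_ax1 x y z w a :
  deformed_endo z w (deformed_endo x y a)
  - deformed_endo y w (deformed_endo x z a)
  - deformed_endo x (deformed_lts y z w) a
  + repD deformed_endo y z (deformed_endo x w a) = 0.
Proof.
rewrite /repD /= -!graph_quotient_action !graph_quotient_bracket_val.
rewrite graph_embedding_bracket -!graph_quotientB -lts_action -graph_quotientD.
rewrite ltsbr_fundamental (ltsbr_skew L (phi y) (L _ _ _)).
rewrite (opprD (_ - _)) addrA subrr sub0r addNr.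
exact: (raddf0 q).
Qed.
Lemma deformed_action_ax2 x y z w a :
  deformed_endo (deformed_lts x y z) w a
  + deformed_endo z (deformed_lts x y w) a =
    repD deformed_endo x y (deformed_endo z w a)
    - deformed_endo z w (repD deformed_endo x y a).
Proof.
rewrite /repD /= -!graph_quotient_action !graph_quotient_bracket_val.
rewrite !graph_embedding_bracket -(graph_quotientB (L (val a) _ _)).
rewrite graph_quotient_bracket_val -!graph_quotientB -graph_quotientD.
rewrite -!lts_action (ltsbr_fundamental L (phi x) (phi y)).
by congr (q _); rewrite -(addrA (L (L _ _ _) _ _)) addrAC subrr add0r.
Qed.

Definition deformed_rep : ltsRepresentation deformed_lts g1 :=
  LtsRepresentation deformed_action_linear1 deformed_action_linear2
    deformed_action_ax1 deformed_action_ax2.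

End QuasiTwilled.

(* Main.v *)
(* The graph of [B] is a subalgebra of [G], onto which [phi u = B u + u] maps
   [g2], and [q] is the projection of [G] onto [g1] along it; they turn the
   bracket of [G] into [.,.,.]_B and the action [varrho]. Strictness gives
   [delta (x, y) v = - q [x, y, phi v]], so the cocycle identity is the image
   under [q] of the fact that [x, y, -] is a derivation of [G]. *)
Require Import Defs.
From mathcomp Require Import all_boot all_algebra.
Import GRing.Theory.
Local Open Scope ring_scope.

(** The only component of [[x, y, B v + v]] absent from [delta] is [[x, y, v]_1], which strictness
    kills. *)
Lemma delta_graph_quotient (K : fieldType) (G : lmodType K) (S1 S2 : pred G)
    (g1 : subLmodType S1) (g2 : subLmodType S2) (L : lieTripleSystem G)
    (dec : direct_decomposition g1 g2) (hG : strict_quasi_twilled L dec)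
    (B : {linear g2 -> g1}) (x y : g1) (v : g2) :
  delta L dec B x y v
    = - graph_quotient dec B (L (val x) (val y) (graph_embedding B v)).
Proof.
rewrite /= /delta_fun /graph_quotient /graph_embedding ltsD3.
rewrite component1D component2D !(strictE hG) addr0 (raddfD B) opprB.
by rewrite [X in X - _]addrC.
Qed.

Theorem proposition4p12 (K : fieldType) (charK : [pchar K] =i pred0)
    (G : lmodType K) (S1 S2 : pred G) (g1 : subLmodType S1)
    (g2 : subLmodType S2) (L : lieTripleSystem G)
    (dec : direct_decomposition g1 g2) (hG : strict_quasi_twilled L dec)
    (B : {linear g2 -> g1}) (hB : deformation_map_II L dec B) :
  forall x y : g1,
    is_1cocycle (deformed_rep hG hB) (delta L dec B x y).
Proof.
move=> x y u v w; rewrite /coboundary1 !delta_graph_quotient //.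
set rho := ltsrep _.
(* Any [a] may represent its class modulo the graph, the kernel of [q]: bracketing with two graph
   elements preserves the graph. *)
have rhoE s t a : rho s t (- graph_quotient dec B a)
    = - graph_quotient dec B (L a (graph_embedding B s) (graph_embedding B t)).
  rewrite raddfN /rho /=; congr (- _).
  by rewrite -(graph_quotient_action B hG) (graph_quotient_bracket_val hG hB).
rewrite /repD !rhoE (graph_embedding_bracket hG hB) ltsbr_fundamental.
(* Of the three derivation terms, the second becomes an action term by skew-symmetry, the third the
   difference defining [repD] by the cyclic identity. *)
rewrite (ltsbr_skew L (graph_embedding B u) (L _ _ _)).
rewrite (lts_action L (graph_embedding B u)) !graph_quotientD.
by rewrite !(raddfN (graph_quotient dec B)) /= -!opprD subrr oppr0.
Qed.
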